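(* For every integer $\ell\ge 1$, the outer multiset dimension of the full $2$-ary tree $T_\ell^2$ of depth $\ell$ is $$\dim_{ms}(T_\ell^2)=\begin{cases}1,&\text{if }\ell=1\\3,&\text{if }\ell=2\\6,&\text{if }\ell=3\\13,&\text{if }\ell=4\\2^{\ell-4}\times 13,&\text{otherwise.}\end{cases}$$
   Context: For a simple connected graph $G=(V,E)$, $d_G(u,v)$ is the length of a shortest $u$–$v$ path. For $S=\{w_1,\ldots,w_t\}\subseteq V$ and $u\in V$, the multiset representation of $u$ with respect to $S$ is the multiset $\operatorname{m}(u|S)$ consisting of $d_G(u,w_1),\ldots,d_G(u,w_t)$, counted with multiplicity. A set $S\subseteq V$ is an outer multiset resolving set of $G$ if $\operatorname{m}(u|S)\ne \operatorname{m}(v|S)$ for every two distinct vertices $u,v\in V\setminus S$. The outer multiset dimension $\dim_{ms}(G)$ is the minimum cardinality of an outer multiset resolving set of $G$. A full $\delta$-ary tree is a rooted tree whose root has degree $\delta$, all of whose leaves are at the same distance from the root (this distance is the depth), and in which every vertex other than the root is either a leaf or a vertex of degree $\delta+1$. *)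

(* Defs.v *)
From mathcomp Require Import all_boot.
From mathcomp Require Import finmap multiset.

Set Implicit Arguments.
Unset Strict Implicit.
Unset Printing Implicit Defensive.

Local Open Scope mset_scope.

Definition simple_graph (T : finType) (e : rel T) : Prop :=
  symmetric e /\ irreflexive e.

Definition connected_graph (T : finType) (e : rel T) : Prop :=
  forall u v : T, connect e u v.

(* A cycle of a graph has at least three vertices; the bound on the size rules
   out the degenerate [ucycle]s [::] and [:: u; v] with u, v adjacent. *)
Definition acyclic_graph (T : finType) (e : rel T) : Prop :=
  forall c : seq T, ucycle e c -> size c <= 2.

Definition tree (T : finType) (e : rel T) : Prop :=
  [/\ simple_graph e, connected_graph e & acyclic_graph e].

Definition degree (T : finType) (e : rel T) (u : T) : nat :=
  #|[set v | e u v]|.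

Definition has_path_of_length (T : finType) (e : rel T) (u v : T) (n : nat)
    : bool :=
  [exists p : n.-tuple T, [&& path e u p, uniq (u :: p) & last u p == v]].

(* A path has fewer than #|T| edges, so the search range is exhaustive; the
   value is #|T| when v is not reachable from u. *)
Definition gdist (T : finType) (e : rel T) (u v : T) : nat :=
  find (has_path_of_length e u v) (iota 0 #|T|).

Definition mrep (T : finType) (e : rel T) (S : {set T}) (u : T) : {mset nat} :=
  seq_mset [seq gdist e u w | w <- enum S].

Definition outer_ms_resolving (T : finType) (e : rel T) (S : {set T}) : bool :=
  [forall u, forall v,
    [&& u \notin S, v \notin S & u != v] ==> (mrep e S u != mrep e S v)].

(* [set: T] is vacuously resolving, so the minimum is over a nonempty family. *)
Definition dim_ms (T : finType) (e : rel T) : nat :=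
  #|[arg min_(S < [set: T] | outer_ms_resolving e S) #|S|]|.

(* The root does not count as a leaf, even when it has degree 1. *)
Definition leaf (T : finType) (e : rel T) (r v : T) : Prop :=
  v <> r /\ degree e v = 1.

Definition full_ary_tree (d l : nat) (T : finType) (e : rel T) (r : T) : Prop :=
  [/\ tree e,
      degree e r = d,
      forall v, leaf e r v -> gdist e r v = l
    & forall v, v <> r -> leaf e r v \/ degree e v = d.+1].

(* Main.v *)
Require Import Defs.
From mathcomp Require Import all_boot.
From mathcomp Require Import finmap multiset zify.

Set Implicit Arguments.
Unset Strict Implicit.
Unset Printing Implicit Defensive.

(** In a tree simple paths are unique, so the vertices of the full binary tree
are the binary words of length at most [l], and the distance of two vertices is
the sum of the lengths of the corresponding words after removing their common
prefix.

Lower bound: if two siblings are outside a resolving set, then their branches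
must have different numbers of selected vertices on some level, since everything
outside the two branches is equidistant from both siblings. Applied from the
leaves upwards, this forces 1, 3 and 6 selected vertices in branches of depth 1,
2 and 3. A set of size 6 at depth 3 must have level counts (0, 0, 1, 5), so two
such branches cannot be siblings and depth 4 needs 13 vertices; from there on
the bound doubles.

Upper bound: vertices of different depths are separated by their largest
distance to a selected leaf. For vertices of equal depth, two resolving sets can
be placed in the two branches of the root as soon as they have different numbers
of leaves. At depth 4 there are resolving sets of size 13 with 9, 10 and 11
leaves, and pairing sets with [a], [a + 1], [a + 2] leaves yields sets with
[2a + 1], [2a + 2], [2a + 3] leaves one level up. *)

(** * Simple paths and distances in acyclic graphs *)

Section Acyclic.

Variables (T : finType) (e : rel T).
Hypothesis e_sym : symmetric e.
Hypothesis e_acy : acyclic_graph e.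

Lemma acyclic_edge x p :
  path e x p -> uniq (x :: p) -> e (last x p) x -> size p <= 1.
Proof.
move=> ep up ex; have := @e_acy (x :: p); apply.
by rewrite /ucycle /= rcons_path ep ex.
Qed.

(** If the first steps [a] and [b] differ, going along [p] to the common end and back along [q]
    joins [a] to [b] without meeting [x]; closing up through [x] gives a cycle. *)
Lemma simple_path_inj x p q :
  path e x p -> uniq (x :: p) -> path e x q -> uniq (x :: q) ->
  last x p = last x q -> p = q.
Proof.
elim: p x q => [|a p IHp] x [|b q] //.
- by move=> _ _ _ /andP[/negP nx _] /= xE; case: nx; rewrite [X in X \in _]xE mem_last.
- by move=> _ /andP[/negP nx _] _ _ /= xE; case: nx; rewrite -[X in X \in _]xE mem_last.
have [<-|neq_ab] := eqVneq a b.
  move=> /andP[_ ep] /andP[_ up] /andP[_ eq] /andP[_ uq] /= lastE.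
  by congr (_ :: _); apply: IHp lastE.
rewrite /= => /andP[exa ep] /andP[xp up] /andP[exb eq] /andP[xq uq] lastE.
exfalso.
have ew : path e a (p ++ rev (belast b q)).
  by rewrite cat_path ep lastE rev_path (eq_path (e' := e)).
have lw : last a (p ++ rev (belast b q)) = b.
  rewrite last_cat lastE; case: (q) => //= c q'.
  by rewrite rev_cons last_rcons.
case/shortenP: ew lw => w ew uw sw lw.
have xw : x \notin a :: w.
  move: xp xq; rewrite !inE !negb_or => /andP[-> xp] /andP[xb xq] /=.
  apply/negP => /sw; rewrite mem_cat mem_rev (negPf xp) /= => /mem_belast.
  by rewrite inE (negPf xb) (negPf xq).
have exw : path e x (a :: w) by rewrite /= exa.
have uxw : uniq (x :: a :: w) by rewrite cons_uniq xw.
have := acyclic_edge exw uxw; rewrite /= lw e_sym => /(_ exb).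
(* Acyclicity leaves only the empty [w], which would make [a] and [b] equal. *)
by case: (w) lw neq_ab => //= ->; rewrite eqxx.
Qed.

(** By uniqueness of simple paths, exactly one length in the search range succeeds. *)
Lemma gdist_simple_path x p :
  path e x p -> uniq (x :: p) -> gdist e x (last x p) = size p.
Proof.
move=> ep up; rewrite /gdist.
have lt_p : size p < #|T|
  by rewrite -[(size p).+1]/(size (x :: p)) -(card_uniqP up) max_card.
rewrite (eq_find (a2 := pred1 (size p))) => [|n].
  have pE : nth 0 (iota 0 #|T|) (size p) = size p by rewrite nth_iota.
  by rewrite -/(index _ _) -{1}pE index_uniq ?size_iota ?iota_uniq.
apply/existsP/eqP => [[q /and3P[eq uq /eqP lq]]|->].
  by rewrite -(simple_path_inj eq uq ep up lq) size_tuple.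
by exists (in_tuple p); rewrite /= ep eqxx andbT.
Qed.

(** Reversing [p] and continuing along [q] is again a simple path. *)
Lemma gdist_branch x p q :
    path e x p -> uniq (x :: p) -> path e x q -> uniq (x :: q) ->
    ~~ has [in p] q ->
  gdist e (last x p) (last x q) = size p + size q.
Proof.
move=> ep up eq uq pq.
have xE : last (last x p) (rev (belast x p)) = x.
  by case: (p) => //= c p'; rewrite rev_cons last_rcons.
have lE : last x q = last (last x p) (rev (belast x p) ++ q) by rewrite last_cat xE.
rewrite lE gdist_simple_path ?size_cat ?size_rev ?size_belast //.
  by rewrite cat_path xE eq andbT rev_path (eq_path (e' := e)).
rewrite -cat_cons -rev_rcons -lastI cat_uniq rev_uniq up.
move: uq => /=/andP[xq uq]; rewrite uq andbT /=; apply/hasPn => z zq.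
rewrite mem_rev inE negb_or (hasPn pq z zq) andbT.
by apply: contraNneq xq => <-.
Qed.

(** A common vertex would be reached from [x] by two simple paths with different first steps. *)
Lemma simple_path_disjoint x a b p q :
    path e x (a :: p) -> uniq (x :: a :: p) ->
    path e x (b :: q) -> uniq (x :: b :: q) -> a != b ->
  ~~ has [in a :: p] (b :: q).
Proof.
move=> ep up eq uq; apply: contra => /hasP[z zq zp].
have split_simple s : path e x s -> uniq (x :: s) -> z \in s ->
    exists2 s', [/\ path e x (rcons s' z), uniq (x :: rcons s' z)
                  & z = last x (rcons s' z)]
      & exists s'', s = rcons s' z ++ s''.
  move=> + + zs; case/path.splitP: zs => s1 s2.
  rewrite cat_path -cat_cons cat_uniq => /andP[es _] /andP[us _].
  by exists s1; [rewrite last_rcons | exists s2].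
have [p1 [ep1 up1 lp1] [p2 pE]] := split_simple _ ep up zp.
have [q1 [eq1 uq1 lq1] [q2 qE]] := split_simple _ eq uq zq.
have pq1 := simple_path_inj ep1 up1 eq1 uq1 (etrans (esym lp1) lq1).
by move: pE qE; rewrite pq1; case: (q1) => [|c q1'] /= [-> _] [-> _].
Qed.

End Acyclic.

(** * Binary words and their tree distance *)

Fixpoint words l : seq (seq bool) :=
  if l is l'.+1
  then [::] :: map (cons false) (words l') ++ map (cons true) (words l')
  else [:: [::]].

Lemma mem_words l s : (s \in words l) = (size s <= l).
Proof.
elim: l s => [|l IHl] [|b s] //=; rewrite inE mem_cat /= ltnS -IHl.
have inj c : injective (cons c : seq bool -> _) by move=> ? ? [].
have neq c d : c != d -> (c :: s \in map (cons d) (words l)) = false.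
  by move=> /eqP cd; apply/mapP => -[t _ [/cd]].
by case: b; rewrite (mem_map (inj _)) neq ?orbF.
Qed.

Lemma words_uniq l : uniq (words l).
Proof.
have inj c : injective (cons c : seq bool -> _) by move=> ? ? [].
elim: l => //= l IHl; rewrite cat_uniq !map_inj_uniq // IHl mem_cat andbT.
rewrite negb_or; apply/andP; split; first by apply/andP; split; apply/mapP => -[].
by apply/hasPn => _ /mapP[t _ ->]; apply/mapP => -[].
Qed.

Fixpoint wdist (u v : seq bool) : nat :=
  match u, v with
  | b :: u', c :: v' => if b == c then wdist u' v' else size u + size v
  | _, _ => size u + size v
  end.

Lemma wdist_le u v : wdist u v <= size u + size v.
Proof.
elim: u v => [|b u IHu] [|c v] //=; case: eqP => // _.
by have := IHu v; lia.
Qed.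

Lemma wdist_eq0 u v : wdist u v = 0 -> u = v.
Proof. by elim: u v => [|b u IHu] [|c v] //=; case: eqP => // -> /IHu ->. Qed.

(** * Coding the vertices of a full binary tree by words *)

Section FullTree.

Variables (l : nat) (T : finType) (e : rel T) (r : T).
Hypothesis hT : full_ary_tree 2 l e r.

Let e_sym : symmetric e. Proof. by case: hT => -[[]]. Qed.
Let e_irr : irreflexive e. Proof. by case: hT => -[[]]. Qed.
Let e_acy : acyclic_graph e. Proof. by case: hT => -[]. Qed.
Let e_con : connected_graph e. Proof. by case: hT => -[]. Qed.

(* A state is a vertex together with its parent; the root is its own parent,
   which by irreflexivity excludes none of its neighbours. *)
Definition kids (st : T * T) : seq T := enum [set z | e st.2 z & z != st.1].

Definition step (st : T * T) (b : bool) : T * T :=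
  (st.2, nth st.2 (kids st) b).

(** Guards against the default of [nth] in [step]: every bit must be read at a vertex with exactly
    two children. *)
Fixpoint full_along (st : T * T) (s : seq bool) : bool :=
  if s is b :: s' then (size (kids st) == 2) && full_along (step st b) s'
  else true.

Fixpoint down (st : T * T) (s : seq bool) : seq T :=
  if s is b :: s' then (step st b).2 :: down (step st b) s' else [::].

Lemma mem_kids st z : (z \in kids st) = e st.2 z && (z != st.1).
Proof. by rewrite mem_enum inE. Qed.

Lemma step_kids st b : size (kids st) = 2 -> (step st b).2 \in kids st.
Proof. by move=> sz; rewrite mem_nth // sz; case: b. Qed.

Lemma last_down st s : last st.2 (down st s) = (foldl step st s).2.
Proof. by elim: s st => //= b s IHs st; rewrite -IHs. Qed.

Lemma size_down st s : size (down st s) = size s.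
Proof. by elim: s st => //= b s IHs st; rewrite IHs. Qed.

Lemma full_along_rcons st s b :
  full_along st (rcons s b) =
  full_along st s && (size (kids (foldl step st s)) == 2).
Proof. by elim: s st => [|c s IHs] st /=; rewrite ?andbT ?IHs ?andbA. Qed.

Lemma down_rcons st s b :
  down st (rcons s b) = rcons (down st s) (step (foldl step st s) b).2.
Proof. by elim: s st => //= c s IHs st; rewrite IHs. Qed.

Lemma down_path st s : full_along st s -> path e st.2 (down st s).
Proof.
elim: s st => //= b s IHs st /andP[/eqP sz fs]; rewrite (IHs (step st b)) // andbT.
by have := step_kids b sz; rewrite mem_kids => /andP[].
Qed.

(* A walk that never goes straight back to where it came from is simple. *)
Lemma down_uniq st s : full_along st s -> uniq (st.2 :: down st s).
Proof.
elim: s st => // b s IHs st fs.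
have ep := down_path fs; move: ep fs.
rewrite [down _ _]/= [full_along _ _]/= [path _ _ _]/=.
move=> /andP[exa ep] /andP[_ fs]; have up := IHs _ fs.
rewrite cons_uniq up andbT inE negb_or; apply/andP; split.
  by apply/eqP => E; move: exa; rewrite -/(step st b).2 -E e_irr.
(* A later return to the start would close a cycle, so by acyclicity it would have to be an
   immediate step back. *)
have back : ohead (down (step st b) s) != Some st.2.
  case: (s) fs => //= c s' /andP[/eqP sz _].
  by have := step_kids c sz; rewrite mem_kids => /andP[_].
apply/negP => xp; case/path.splitP: xp ep up back => p1 p2.
rewrite cat_path -cat_cons cat_uniq => /andP[ep _] /andP[up _].
have := acyclic_edge e_acy ep up; rewrite last_rcons size_rcons => /(_ exa).
by case: (p1) => //=; rewrite eqxx.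
Qed.

(** Induction strips the common prefix; at the first differing bit the two paths enter different
    children and stay disjoint. *)
Lemma gdist_down st s t : full_along st s -> full_along st t ->
  gdist e (foldl step st s).2 (foldl step st t).2 = wdist s t.
Proof.
elim: s t st => [|b s IHs] [|c t] st fs ft.
1-3: by rewrite -!last_down (gdist_branch e_sym e_acy) ?down_path ?down_uniq
  ?size_down //=; apply/hasPn.
rewrite /=; case: eqVneq => [Ebc|neq_bc].
  by move: fs ft; rewrite -Ebc /= => /andP[_ fs] /andP[_ ft]; apply: IHs.
have /andP[/eqP sz _] := fs.
rewrite -[foldl step (step st b) s]/(foldl step st (b :: s)).
rewrite -[foldl step (step st c) t]/(foldl step st (c :: t)).
rewrite -!last_down (gdist_branch e_sym e_acy) ?down_path ?down_uniq ?size_down //.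
apply: (simple_path_disjoint e_sym e_acy (down_path fs) (down_uniq fs)
         (down_path ft) (down_uniq ft)).
rewrite /= nth_uniq ?enum_uniq ?sz; first by case: (b) (c) neq_bc => -[].
all: by case: (b) (c) => -[].
Qed.

Definition vertex (s : seq bool) : T := (foldl step (r, r) s).2.

Lemma gdist_root s : full_along (r, r) s -> gdist e r (vertex s) = size s.
Proof. by move=> fs; rewrite -[r in LHS]/(vertex [::]) gdist_down. Qed.

Lemma card_kids s : full_along (r, r) s ->
  size (kids (foldl step (r, r) s)) = 2 \/
  size s = l /\ kids (foldl step (r, r) s) = [::].
Proof.
case/lastP: s => [|s b] fs.
  left; case: hT => _ deg_r _ _; rewrite -cardE -deg_r; apply: eq_card => z.
  by rewrite !inE /=; case: eqVneq => [->|]; rewrite ?e_irr ?andbT.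
have := down_uniq fs; have := gdist_root fs.
rewrite down_rcons -rcons_cons rcons_uniq /vertex foldl_rcons.
set st := foldl step (r, r) s.
set x := (step st b).2 => xl /andP[xs _].
have /(step_kids b) : size (kids st) = 2.
  by apply/eqP; move: fs; rewrite full_along_rcons => /andP[].
rewrite -/x mem_kids e_sym => /andP[ex _].
have degE : degree e x = (size (kids (step st b))).+1.
  rewrite /degree (cardsD1 st.2) inE ex -cardE add1n; congr _.+1.
  by apply: eq_card => z; rewrite !inE andbC.
have x_r : x <> r by move=> xr; move: xs; rewrite xr mem_head.
case: hT => _ _ hleaf hdeg.
case: (hdeg x x_r) => [lx|]; last by rewrite degE => -[]; left.
right; rewrite -xl; split; first exact: hleaf.
by case: lx => _; rewrite degE => -[] /size0nil.
Qed.

(** Leaves occur only at depth [l], so a vertex of that depth with children would start an endless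
    descent in a finite tree. *)
Lemma kids_leaf s : full_along (r, r) s -> size s = l ->
  kids (foldl step (r, r) s) = [::].
Proof.
move=> fs sl; case: (card_kids fs) => [sz|[]//].
have fsn n : full_along (r, r) (s ++ nseq n false).
  elim: n => [|n IHn]; first by rewrite cats0.
  rewrite -addn1 nseqD catA cats1 full_along_rcons IHn /=; apply/eqP.
  case: n IHn => [|n] fn; first by rewrite cats0.
  by case: (card_kids fn) => [//|[]]; rewrite size_cat size_nseq sl; lia.
(* This simple path has more than [#|T|] vertices. *)
have /card_uniqP := down_uniq (fsn #|T|).
have := max_card [in r :: down (r, r) (s ++ nseq #|T| false)].
by move=> + E; rewrite E /= size_down size_cat size_nseq; lia.
Qed.

Lemma full_along_le s : size s <= l -> full_along (r, r) s.
Proof.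
elim/last_ind: s => // s b IHs; rewrite size_rcons => lt_s.
rewrite full_along_rcons IHs 1?ltnW //.
by case: (card_kids (IHs (ltnW lt_s))) => [->//|[]]; lia.
Qed.

Lemma gdist_vertex s t : size s <= l -> size t <= l ->
  gdist e (vertex s) (vertex t) = wdist s t.
Proof. by move=> ls lt; rewrite gdist_down ?full_along_le. Qed.

Lemma vertex_inj s t : size s <= l -> size t <= l -> vertex s = vertex t -> s = t.
Proof.
move=> ls lt E; apply: wdist_eq0; rewrite -gdist_vertex // -E.
by rewrite gdist_vertex //; elim: (s) => //= b u IHu; rewrite eqxx.
Qed.

Lemma parent_mem s : (foldl step (r, r) s).1 \in r :: down (r, r) s.
Proof.
case/lastP: s => [|s b]; first by rewrite mem_head.
rewrite foldl_rcons down_rcons -rcons_cons mem_rcons inE.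
by rewrite [X in X \in _]/= -last_down (mem_last r) orbT.
Qed.

(** Simplicity keeps the next vertex from being the parent, so it is one of the two children and is
    named by a bit. *)
Lemma down_surj p : path e r p -> uniq (r :: p) ->
  exists2 s, size s <= l & down (r, r) s = p.
Proof.
elim/last_ind: p => [|p z IHp]; first by exists [::].
rewrite rcons_path -rcons_cons rcons_uniq => /andP[ep ez] /andP[zp up].
have [s ls sE] := IHp ep up.
have fs := full_along_le ls.
have zk : z \in kids (foldl step (r, r) s).
  rewrite mem_kids -last_down sE ez /=.
  by apply: contraNneq zp => ->; rewrite -sE parent_mem.
have lt_s : size s < l.
  rewrite ltn_neqAle ls andbT; apply/eqP => sl.
  by rewrite kids_leaf in zk.
have sz : size (kids (foldl step (r, r) s)) = 2 by case: (card_kids fs) => // -[]; lia.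
exists (rcons s (index z (kids (foldl step (r, r) s)) == 1)).
  by rewrite size_rcons.
rewrite down_rcons sE /=; congr rcons.
have := nth_index (foldl step (r, r) s).2 zk.
by have := zk; rewrite -index_mem sz; case: index => [|[|]].
Qed.

Lemma vertex_surj v : exists2 s, size s <= l & vertex s = v.
Proof.
have /connectP[p ep ->] := e_con r v.
case/shortenP: ep => q eq uq _; have [s ls <-] := down_surj eq uq.
by exists s; rewrite // (last_down (r, r)).
Qed.

Lemma enum_vertex : perm_eq (enum T) (map vertex (words l)).
Proof.
apply: uniq_perm; first exact: enum_uniq.
  rewrite map_inj_in_uniq ?words_uniq // => s t; rewrite !mem_words.
  exact: vertex_inj.
move=> v; rewrite mem_enum inE; symmetry.
by have [s ls <-] := vertex_surj v; rewrite map_f // mem_words.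
Qed.

End FullTree.

(** * Resolving predicates on words *)

Definition weight (P : pred (seq bool)) l := count P (words l).

(** This is the multiplicity of [d] in the multiset representation of [u]. *)
Definition profile (P : pred (seq bool)) l u d :=
  count (fun s => P s && (wdist u s == d)) (words l).

Definition level (P : pred (seq bool)) l d := profile P l [::] d.

Definition branch (P : pred (seq bool)) b : pred (seq bool) :=
  fun s => P (b :: s).

(** The restriction to equal lengths makes the condition pass to branches: prefixing a bit adds
    profile terms that depend only on the length. *)
Definition level_resolving l (P : pred (seq bool)) :=
  forall u v, size u <= l -> size u = size v -> ~~ P u -> ~~ P v ->
  profile P l u =1 profile P l v -> u = v.

Definition resolving l (P : pred (seq bool)) :=
  forall u v, size u <= l -> size v <= l -> ~~ P u -> ~~ P v ->
  profile P l u =1 profile P l v -> u = v.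

Lemma resolving_level_resolving l P : resolving l P -> level_resolving l P.
Proof. by move=> rP u v ul uv; apply: rP; rewrite // -uv. Qed.

Lemma count_words P l :
  count P (words l.+1) = P [::] + count (branch P false) (words l) +
    count (branch P true) (words l).
Proof. by rewrite /= count_cat !count_map addnA. Qed.

(** The summands count the root, the branch of the word, and the other branch, all of whose paths to
    the word pass through the root. *)
Lemma profile_cons P l b u d :
  profile P l.+1 (b :: u) d =
  (P [::] && ((size u).+1 == d)) + profile (branch P b) l u d +
  ((size u).+2 <= d) * level (branch P (~~ b)) l (d - (size u).+2).
Proof.
rewrite /profile count_words /= addn0.
have far : count (branch (fun s => P s && (wdist (b :: u) s == d)) (~~ b)) (words l) =
    ((size u).+2 <= d) * level (branch P (~~ b)) l (d - (size u).+2).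
  case: (boolP (_ < d)) => [le_d|gt_d]; rewrite !(mul1n, mul0n).
    rewrite /level /profile; apply: eq_count => s; rewrite /branch /=; congr (_ && _).
    by case: (b) => /=; lia.
  rewrite -[RHS](count_pred0 (words l)); apply: eq_count => s.
  rewrite /branch /=; apply/negbTE; rewrite negb_and; apply/orP; right.
  by case: (b) => /=; lia.
have near : count (branch (fun s => P s && (wdist (b :: u) s == d)) b) (words l) =
    count (fun s => branch P b s && (wdist u s == d)) (words l).
  by apply: eq_count => s; rewrite /branch /= eqxx.
by rewrite -far -near; case: (b) => /=; lia.
Qed.

Lemma levelS P l d :
  level P l.+1 d.+1 = level (branch P false) l d + level (branch P true) l d.
Proof. by rewrite /level /profile count_words /= andbF. Qed.

Lemma level0 P l : level P l 0 = P [::].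
Proof.
case: l => [|l]; rewrite /level /profile; first by rewrite /= andbT addn0.
rewrite count_words /= andbT.
rewrite !(eq_count (a2 := pred0)) ?count_pred0 ?addn0 // => s.
all: by rewrite /branch /= andbF.
Qed.

Lemma weightS P l :
  weight P l.+1 = P [::] + weight (branch P false) l + weight (branch P true) l.
Proof. exact: count_words. Qed.

Lemma weight0 P : weight P 0 = P [::].
Proof. by rewrite /weight /= addn0. Qed.

Lemma level_resolving_branch l P b :
  level_resolving l.+1 P -> level_resolving l (branch P b).
Proof.
move=> rP u v ul uv Pu Pv Euv; suff [] : b :: u = b :: v by [].
by apply: rP => //=; [rewrite uv | move=> d; rewrite !profile_cons uv Euv].
Qed.

(* Vertices outside the branches of two siblings are equidistant from both. *)
Lemma siblings_levels l P : level_resolving l.+1 P ->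
    level (branch P false) l =1 level (branch P true) l ->
  P [:: false] || P [:: true].
Proof.
move=> rP E; apply/negPn/negP; rewrite negb_or => /andP[P0 P1].
suff [] : [:: false] = [:: true] by [].
by apply: rP => // d; rewrite !profile_cons /= -!/(level _ _ _) !E.
Qed.

Lemma profile_far P l u d : size u + l < d -> profile P l u d = 0.
Proof.
move=> ld; apply/eqP; rewrite -leqn0 leqNgt -has_count; apply/hasPn => s.
rewrite mem_words => sl; apply/negP => /andP[_ /eqP E]; have := wdist_le u s.
by rewrite E leqNgt (leq_ltn_trans _ ld) // leq_add2l.
Qed.

Definition join (P0 P1 : pred (seq bool)) : pred (seq bool) :=
  fun s => if s is b :: s' then (if b then P1 s' else P0 s') else false.

(* The vertices of one branch at a given depth see the leaves of the other
   branch at the maximal possible distance. *)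
Lemma level_resolving_join l P0 P1 :
    level_resolving l P0 -> level_resolving l P1 ->
    level P0 l l <> level P1 l l ->
  level_resolving l.+1 (join P0 P1).
Proof.
move=> r0 r1 neq; set P := join P0 P1.
have rb b : level_resolving l (branch P b) by case: b.
case=> [|b u] [|c v] //=; rewrite ltnS => ul [uv] Pu Pv E.
have [bc|neq_bc] := eqVneq b c.
  rewrite -{}bc in Pv E *; congr (_ :: _); apply: (rb b) => // d.
  by have := E d; rewrite !profile_cons uv; lia.
(* At this distance only the leaves of the opposite branch contribute. *)
have := E ((size u).+2 + l); rewrite !profile_cons uv !profile_far; try lia.
rewrite leq_addr addKn; case: (b) (c) neq_bc => -[] //= _.
  by rewrite !mul1n => /neq.
by rewrite !mul1n => /esym/neq.
Qed.

(** A criterion decidable by computation; distances are at most [l.*2], whence the length of the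
    lists. *)
Lemma uniq_profiles_resolving l P :
    uniq [seq mkseq (profile P l u) l.*2.+1 | u <- words l & ~~ P u] ->
  resolving l P.
Proof.
set s := [seq _ <- _ | _] => /(uniqP [::]) us u v ul vl Pu Pv E.
have us' : u \in s by rewrite mem_filter Pu mem_words.
have vs' : v \in s by rewrite mem_filter Pv mem_words.
rewrite -(nth_index [::] us') -(nth_index [::] vs'); congr nth.
apply: us; rewrite ?inE ?size_map ?index_mem //.
by rewrite !(nth_map [::]) ?index_mem // !nth_index //; apply: eq_mkseq.
Qed.

Lemma level_nth P l s t :
    level (branch P false) l =1 nth 0 s -> level (branch P true) l =1 nth 0 t ->
  forall d, level P l.+1 d = if d is d'.+1 then nth 0 s d' + nth 0 t d' else P [::].
Proof. by move=> Es Et [|d]; rewrite ?level0 // levelS Es Et. Qed.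

Lemma siblings_nth l P s : level_resolving l.+1 P -> nth 0 s 0 = 0 ->
    level (branch P false) l =1 nth 0 s -> level (branch P true) l =1 nth 0 s ->
  False.
Proof.
move=> rP s0 E0 E1; have := siblings_levels rP (ftrans E0 (fsym E1)).
have := E0 0; have := E1 0; rewrite !level0 s0 /branch.
by do 2!case: (P _).
Qed.

(** * Level counts and lower bounds *)

Lemma level_depth0 P : level P 0 =1 nth 0 [:: P [::] : nat].
Proof. by case=> [|d]; rewrite ?level0 // /level profile_far //= nth_nil. Qed.

Lemma level_depth1 P :
  level P 1 =1 nth 0 [:: P [::] : nat; P [:: false] + P [:: true]].
Proof.
move=> d; rewrite (level_nth (level_depth0 _) (level_depth0 _)).
by case: d => [|[|d]] //=; rewrite nth_nil.
Qed.

Lemma weight_depth1 P : weight P 1 = P [::] + P [:: false] + P [:: true].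
Proof. by rewrite weightS !weight0. Qed.

Lemma leaf_pair P : level_resolving 1 P -> P [:: false] || P [:: true].
Proof.
move=> rP; apply/negPn/negP; rewrite negb_or => /andP[/negPf P0 /negPf P1].
by apply: (siblings_nth (s := [:: 0]) rP) => // d; rewrite level_depth0 /branch ?P0 ?P1.
Qed.

(** Descending through branches ends at two sibling leaves, one of which is selected. *)
Lemma level_resolving_leaf l P :
  level_resolving l.+1 P -> 0 < level P l.+1 l.+1.
Proof.
elim: l P => [|l IHl] P rP; rewrite levelS addn_gt0.
  have := leaf_pair rP; rewrite !level0 /branch.
  by do 2!case: (P _).
by rewrite IHl //; apply: level_resolving_branch rP.
Qed.

(* Both branches of the root contain selected leaves, so the depth of a vertex
   is read off the largest distance in its profile. *)
Lemma level_resolving_resolving l P :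
  level_resolving l.+2 P -> resolving l.+2 P.
Proof.
move=> rP u v ul vl Pu Pv Euv.
have Lb b : 0 < level (branch P b) l.+1 l.+1.
  exact/level_resolving_leaf/level_resolving_branch.
have sep w w' : size w < size w' -> profile P l.+2 w =1 profile P l.+2 w' -> False.
  (* This is the distance from [b :: w'] to the leaves of the other branch; no shorter word attains
     it. *)
  case: w' => // b w' ww' E; have := E (size w' + l.+1).+2.
  rewrite profile_far ?profile_cons; last by move: ww' => /=; lia.
  rewrite (_ : (size w').+1 < _ = true); last by lia.
  rewrite (_ : _ - _ = l.+1); last by lia.
  by have := Lb (~~ b); lia.
have [uv|uv|uv] := ltngtP (size u) (size v).
- by case: (sep u v).
- by case: (sep v u) => // d; rewrite Euv.
- exact: rP.
Qed.

Lemma weight1_ge P : level_resolving 1 P ->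
  1 <= weight P 1 /\ (weight P 1 = 1 -> level P 1 =1 nth 0 [:: 0; 1]).
Proof.
move=> /leaf_pair; rewrite weight_depth1 => PP; split; first by lia.
move=> w1 d; rewrite level_depth1.
have -> : P [::] = false by lia.
by have -> : P [:: false] + P [:: true] = 1 by lia.
Qed.

Lemma weight1_eq2 P : weight P 1 = 2 ->
  level P 1 =1 nth 0 [:: 1; 1] \/ level P 1 =1 nth 0 [:: 0; 2].
Proof.
rewrite weight_depth1 => w2.
case Pr: (P [::]) w2 => w2; [left | right] => d; rewrite level_depth1 Pr.
  by have -> : P [:: false] + P [:: true] = 1 by lia.
by have -> : P [:: false] + P [:: true] = 2 by lia.
Qed.

(** Two branches of weight 1 would have the same levels (0, 1). Weight 3 thus splits as 1 + 2, the
    heavier branch having levels (1, 1) or (0, 2). *)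
Lemma weight2_ge P : level_resolving 2 P ->
  3 <= weight P 2 /\ (weight P 2 = 3 ->
    level P 2 =1 nth 0 [:: 0; 1; 2] \/ level P 2 =1 nth 0 [:: 0; 0; 3]).
Proof.
move=> rP; rewrite weightS.
have r0 := level_resolving_branch (b := false) rP.
have r1 := level_resolving_branch (b := true) rP.
have [w0 e0] := weight1_ge r0; have [w1 e1] := weight1_ge r1.
have n11 : ~ (weight (branch P false) 1 = 1 /\ weight (branch P true) 1 = 1).
  by move=> [/e0 E0 /e1 E1]; apply: (siblings_nth rP _ E0 E1).
split=> [|w3]; first by lia.
have Pr : P [::] = false by lia.
have [[/e0 E0 /weight1_eq2[] E1]|[/weight1_eq2[] E0 /e1 E1]] :
    weight (branch P false) 1 = 1 /\ weight (branch P true) 1 = 2 \/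
    weight (branch P false) 1 = 2 /\ weight (branch P true) 1 = 1 by lia.
all: try by left=> d; rewrite (level_nth E0 E1) Pr;
  case: d => [|[|[|d]]] //=; rewrite nth_nil.
all: by right=> d; rewrite (level_nth E0 E1) Pr;
  case: d => [|[|[|d]]] //=; rewrite nth_nil.
Qed.

(** At weight 6 both branches have weight 3 and different levels, so these are (0, 1, 2) and (0, 0,
    3), with sum (0, 1, 5) one level down. *)
Lemma weight3_ge P : level_resolving 3 P ->
  6 <= weight P 3 /\ (weight P 3 = 6 -> level P 3 =1 nth 0 [:: 0; 0; 1; 5]).
Proof.
move=> rP; rewrite weightS.
have [w0 e0] := weight2_ge (level_resolving_branch (b := false) rP).
have [w1 e1] := weight2_ge (level_resolving_branch (b := true) rP).
split=> [|w6]; first by lia.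
have Pr : P [::] = false by lia.
have /e0 E0 : weight (branch P false) 2 = 3 by lia.
have /e1 E1 : weight (branch P true) 2 = 3 by lia.
case: E0 E1 => E0 [] E1; try by case: (siblings_nth rP _ E0 E1).
all: move=> d; rewrite (level_nth E0 E1) Pr.
all: by case: d => [|[|[|[|d]]]] //=; rewrite nth_nil.
Qed.

Lemma weight4_ge P : level_resolving 4 P -> 13 <= weight P 4.
Proof.
move=> rP; rewrite weightS.
have [w0 e0] := weight3_ge (level_resolving_branch (b := false) rP).
have [w1 e1] := weight3_ge (level_resolving_branch (b := true) rP).
rewrite ltnNge; apply/negP => w12.
apply: (siblings_nth rP (s := [:: 0; 0; 1; 5])) => //.
  by apply: e0; lia.
by apply: e1; lia.
Qed.

Lemma weight_ge l P : level_resolving (4 + l) P -> 2 ^ l * 13 <= weight P (4 + l).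
Proof.
elim: l P => [|l IHl] P; first exact: weight4_ge.
rewrite addnS weightS => rP.
have := IHl _ (level_resolving_branch (b := false) rP).
have := IHl _ (level_resolving_branch (b := true) rP).
by rewrite expnS; lia.
Qed.

(** * Construction of resolving sets for the upper bound *)

Definition attains l n a (P : pred (seq bool)) :=
  [/\ level_resolving l P, weight P l = n & level P l l = a].

Lemma attains_join l n a b P Q : a <> b ->
  attains l n a P -> attains l n b Q -> attains l.+1 (2 * n) (a + b) (join P Q).
Proof.
move=> ab [rP wP lP] [rQ wQ lQ]; split.
- by apply: level_resolving_join; rewrite ?lP ?lQ.
- rewrite weightS /= -[weight (branch _ false) l]/(weight P l).
  by rewrite -[weight (branch _ true) l]/(weight Q l) wP wQ; lia.
- rewrite levelS -[level (branch _ false) l l]/(level P l l).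
  by rewrite -[level (branch _ true) l l]/(level Q l l) lP lQ.
Qed.

Definition word_set (s : seq (seq nat)) : pred (seq bool) :=
  fun u => u \in [seq [seq b == 1 | b <- w] | w <- s].

(* Three consecutive leaf counts are reproduced one level up by the pairwise
   sums, so that there are always two sets with different leaf counts. *)
Lemma attains_ge4 l : exists a,
  forall i, i < 3 -> exists P, attains (4 + l) (2 ^ l * 13) (a + i) P.
Proof.
elim: l => [|l [a IHl]].
  exists 9 => -[|[|[|]]] // _.
  - exists (word_set
      [:: [:: 1; 0]; [:: 0; 0; 0]; [:: 1; 0; 0]; [:: 1; 1; 0];
          [:: 0; 0; 0; 0]; [:: 0; 0; 1; 0]; [:: 0; 1; 0; 0]; [:: 0; 1; 0; 1];
          [:: 0; 1; 1; 0]; [:: 1; 0; 0; 0]; [:: 1; 0; 1; 0]; [:: 1; 1; 0; 0];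
          [:: 1; 1; 1; 0]]).
    by split; [apply/resolving_level_resolving/uniq_profiles_resolving| |]; vm_compute.
  - exists (word_set
      [:: [:: 1]; [:: 0; 0; 0]; [:: 1; 0; 0]; [:: 0; 0; 0; 0];
          [:: 0; 0; 1; 0]; [:: 0; 1; 0; 0]; [:: 0; 1; 0; 1]; [:: 0; 1; 1; 0];
          [:: 1; 0; 0; 0]; [:: 1; 0; 1; 0]; [:: 1; 1; 0; 0]; [:: 1; 1; 0; 1];
          [:: 1; 1; 1; 0]]).
    by split; [apply/resolving_level_resolving/uniq_profiles_resolving| |]; vm_compute.
  - exists (word_set
      [:: [:: 0; 0; 0]; [:: 1; 0; 0]; [:: 0; 0; 0; 0]; [:: 0; 0; 1; 0];
          [:: 0; 1; 0; 0]; [:: 0; 1; 0; 1]; [:: 0; 1; 1; 0]; [:: 1; 0; 0; 0];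
          [:: 1; 0; 0; 1]; [:: 1; 0; 1; 0]; [:: 1; 1; 0; 0]; [:: 1; 1; 0; 1];
          [:: 1; 1; 1; 0]]).
    by split; [apply/resolving_level_resolving/uniq_profiles_resolving| |]; vm_compute.
exists (a + a.+1) => i i3.
have [[P0 H0] [P1 H1] [P2 H2]] := And3 (IHl 0 isT) (IHl 1 isT) (IHl 2 isT).
rewrite addnS expnS -mulnA.
case: i i3 => [|[|[|]]] // _.
- exists (join P0 P1); rewrite (_ : _ + 0 = a + 0 + (a + 1)); last by lia.
  by apply: attains_join => //; lia.
- exists (join P0 P2); rewrite (_ : _ + 1 = a + 0 + (a + 2)); last by lia.
  by apply: attains_join => //; lia.
- exists (join P1 P2); rewrite (_ : _ + 2 = a + 1 + (a + 2)); last by lia.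
  by apply: attains_join => //; lia.
Qed.

Lemma eq_resolving l P Q : (forall s, size s <= l -> P s = Q s) ->
  resolving l P -> resolving l Q.
Proof.
move=> PQ rP u v ul vl; rewrite -!PQ // => Pu Pv E; apply: rP => // d.
have profE w : profile P l w d = profile Q l w d.
  by apply: eq_in_count => s; rewrite mem_words => /PQ ->.
by rewrite !profE.
Qed.

(** * Transfer from words to the graph *)

Section Dimension.

Variables (l : nat) (T : finType) (e : rel T) (r : T).
Hypothesis hT : full_ary_tree 2 l e r.

Let vtx := vertex e r.

Lemma count_vertex (S : {set T}) (Q : pred T) :
  count Q (enum S) = count (fun s => (vtx s \in S) && Q (vtx s)) (words l).
Proof.
have -> : enum S = [seq v <- enum T | v \in S] by rewrite enumT.
rewrite count_filter (permP (enum_vertex hT)) count_map.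
by apply: eq_count => s; rewrite /= andbC.
Qed.

Lemma card_vertex (S : {set T}) : #|S| = weight (fun s => vtx s \in S) l.
Proof.
rewrite cardE -(count_predT (enum S)) count_vertex.
by apply: eq_count => s; rewrite andbT.
Qed.

Lemma mrep_vertex (S : {set T}) s d : size s <= l ->
  mrep e S (vtx s) d = profile (fun t => vtx t \in S) l s d.
Proof.
move=> sl; rewrite /mrep mset_seqE count_map count_vertex.
by apply: eq_in_count => t; rewrite mem_words /= => tl; rewrite (gdist_vertex hT).
Qed.

Lemma outer_ms_resolving_vertex (S : {set T}) :
  outer_ms_resolving e S <-> resolving l (fun s => vtx s \in S).
Proof.
split=> [rS s t sl tl Ss St E|rS].
  apply: (vertex_inj hT sl tl); apply/eqP/negPn/negP => neq.
  have /forallP/(_ (vtx s))/forallP/(_ (vtx t)) := rS.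
  rewrite Ss St neq /=; case/eqP; apply/msetP => d.
  by rewrite !mrep_vertex.
apply/forallP => u; apply/forallP => v; apply/implyP => /and3P[Su Sv].
have [s sl sE] := vertex_surj hT u; have [t tl tE] := vertex_surj hT v.
rewrite -sE -tE in Su Sv *; apply: contraNneq => E; suff -> : s = t by [].
by apply: rS => // d; rewrite -!mrep_vertex // E.
Qed.

Lemma dim_ms_vertex n :
    (forall P, resolving l P -> n <= weight P l) ->
    (exists2 P, resolving l P & weight P l = n) ->
  dim_ms e = n.
Proof.
move=> lb [P rP wP]; rewrite /dim_ms; case: arg_minnP => [|S rS minS].
  by apply/forallP => u; apply/forallP => v; rewrite inE.
apply/eqP; rewrite eqn_leq andbC card_vertex lb; last exact/outer_ms_resolving_vertex.
(* The vertex set coded by [P], against which the minimal [S] is compared. *)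
pose S' := [set v in map vtx (filter P (words l))].
have inS s : size s <= l -> (vtx s \in S') = P s.
  move=> sl; rewrite inE; apply/mapP/idP => [[t]|Ps]; last first.
    by exists s; rewrite // mem_filter Ps mem_words.
  by rewrite mem_filter mem_words => /andP[Pt tl] /(vertex_inj hT sl tl) ->.
rewrite -card_vertex; apply: leq_trans (minS S' _) _.
  by apply/outer_ms_resolving_vertex; apply: eq_resolving rP => s /inS ->.
rewrite -wP card_vertex eq_leq //; apply: eq_in_count => s.
by rewrite mem_words => /inS.
Qed.

End Dimension.

Theorem corollary5p4 (l : nat) (hl : 1 <= l)
    (T : finType) (e : rel T) (r : T) (hT : full_ary_tree 2 l e r) :
  dim_ms e = match l with
             | 1 => 1
             | 2 => 3
             | 3 => 6
             | 4 => 13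
             | _ => 2 ^ (l - 4) * 13
             end.
Proof.
case: l hl hT => [//|[|[|[|l]]]] _ hT; apply: (dim_ms_vertex hT).
- by move=> P /resolving_level_resolving/weight1_ge[].
- exists (word_set [:: [:: 0]]); last by vm_compute.
  by apply: uniq_profiles_resolving; vm_compute.
- by move=> P /resolving_level_resolving/weight2_ge[].
- exists (word_set [:: [:: 0]; [:: 0; 0]; [:: 1; 0]]); last by vm_compute.
  by apply: uniq_profiles_resolving; vm_compute.
- by move=> P /resolving_level_resolving/weight3_ge[].
(* The witness necessarily has the level counts (0, 0, 1, 5). *)
- exists (word_set [:: [:: 0; 0]; [:: 0; 0; 0]; [:: 0; 1; 0];
                       [:: 1; 0; 0]; [:: 1; 0; 1]; [:: 1; 1; 0]]).
    by apply: uniq_profiles_resolving; vm_compute.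
  by vm_compute.
(* The depth is now [l.+4], and depth 4 fits the general formula at [l = 0]. *)
- have -> : match l with 0 => 13 | _ => 2 ^ (l.+4 - 4) * 13 end = 2 ^ l * 13.
    by case: l {hT} => // l; rewrite -[l.+1.+4]/(4 + l.+1) addKn.
  by move=> P /resolving_level_resolving; apply: weight_ge.
- have -> : match l with 0 => 13 | _ => 2 ^ (l.+4 - 4) * 13 end = 2 ^ l * 13.
    by case: l {hT} => // l; rewrite -[l.+1.+4]/(4 + l.+1) addKn.
  have [a /(_ 0 isT)[P [rP wP lP]]] := attains_ge4 l.
  by exists P; first exact: level_resolving_resolving.
Qed.
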